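(* Let $f$ be a location function on the $n$-cube $Q_n$. Then $f=Med$ if and only if $f$ satisfies (T), (Maj), and (RR).
   Context: $Q_n=(X,E)$ is the $n$-dimensional hypercube graph with vertex set $X=\{0,1\}^n$ and distance $d(u,v)=\sum_{i=1}^n|u_i-v_i|$ (Hamming distance). A profile is a finite sequence $\pi=(v_1,\dots,v_k)$ of vertices of $X$ of any length $k\ge 1$; $X^*=\bigcup_{k\ge1}X^k$ is the set of all profiles. A location function (also called consensus function) on $Q_n$ is a map $f:X^*\to 2^X\setminus\{\emptyset\}$. For $u,v\in X$, $u\oplus v$ denotes coordinatewise addition modulo 2, and $\pi\oplus v=(v_1\oplus v,\dots,v_k\oplus v)$. The median function $Med$ is defined by $Med(\pi)=\{x\in X: S_\pi(x)\text{ is minimum}\}$, where $S_\pi(x)=\sum_{i=1}^k d(x,v_i)$ and the minimum is over all $x\in X$. For a profile $\pi=(v_1,\dots,v_k)$ write $v_j=(x_1^j,\dots,x_n^j)\in\{0,1\}^n$ for $j=1,\dots,k$. Translation (T): for every profile $\pi$ and all vertices $u,v\in X$, $u\in f(\pi)$ implies $u\oplus v\in f(\pi\oplus v)$. (Maj): $Maj(\pi)\in f(\pi)$ for every profile $\pi$, where $Maj(\pi)=(w_1,\dots,w_n)\in X$ is the vertex with $w_i=1$ if and only if $\sum_{j=1}^k x_i^j>\frac{k}{2}$, for $i=1,\dots,n$. Restricted Range (RR): $|f(\pi)|\le 2^{Cs(\pi)}$ for every profile $\pi$, where the Condorcet score of $\pi$ is $Cs(\pi)=\left|\{i\in\{1,\dots,n\}:\sum_{j=1}^k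 x_i^j=\frac{k}{2}\}\right|$. *)

(* Defs.v *)
From HB Require Import structures.
From mathcomp Require Import all_boot all_order ssralg ssrint.

Set Implicit Arguments.
Unset Strict Implicit.
Unset Printing Implicit Defensive.

Local Open Scope nat_scope.

(* The bits of a vertex are booleans; in the formulas below they are coerced
   to the natural numbers 0 and 1. *)
Definition cube (n : nat) := {ffun 'I_n -> bool}.

(* The difference is taken in int, not truncated. *)
Definition dist (n : nat) (u v : cube n) : nat := \sum_(i < n) `|u i - v i|%N.

Definition oplus (n : nat) (u v : cube n) : cube n := [ffun i => u i (+) v i].

Record profile (n : nat) := Profile {
  votes :> seq (cube n);
  votes_gt0 : 0 < size votes
}.
HB.instance Definition _ (n : nat) := [isSub for @votes n].

Lemma translate_subproof (n : nat) (p : profile n) (v : cube n) :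
  0 < size [seq oplus w v | w <- p].
Proof. by rewrite size_map votes_gt0. Qed.

Definition translate (n : nat) (p : profile n) (v : cube n) : profile n :=
  Profile (translate_subproof p v).

Record location (n : nat) := Location {
  loc_fun :> profile n -> {set cube n};
  loc_neq0 : forall p : profile n, loc_fun p != set0
}.

Definition remoteness (n : nat) (p : profile n) (x : cube n) : nat :=
  \sum_(v <- votes p) dist x v.

Definition Med (n : nat) (p : profile n) : {set cube n} :=
  [set x | [forall y, remoteness p x <= remoteness p y]].

Definition ones (n : nat) (p : profile n) (i : 'I_n) : nat :=
  \sum_(v <- votes p) v i.

(* Comparisons of [ones p i] with k/2, where k is the length of p, are
   multiplied by 2 to stay within nat. *)
Definition Maj (n : nat) (p : profile n) : cube n :=
  [ffun i => size p < 2 * ones p i].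

Definition Cs (n : nat) (p : profile n) : nat :=
  #|[set i : 'I_n | 2 * ones p i == size p]|.

Definition axiomT (n : nat) (f : location n) : Prop :=
  forall (p : profile n) (u v : cube n),
    u \in f p -> oplus u v \in f (translate p v).

Definition axiomMaj (n : nat) (f : location n) : Prop :=
  forall p : profile n, Maj p \in f p.

Definition axiomRR (n : nat) (f : location n) : Prop :=
  forall p : profile n, #|f p| <= 2 ^ Cs p.

(* Main.v *)
Require Import Defs.
From mathcomp Require Import all_boot zify.

(** The remoteness of [x] is the sum over the coordinates [i] of the number of
    votes that disagree with the bit [x i] ([remotenessE]).  The coordinates can
    therefore be optimized independently: the majority bit is optimal
    everywhere, and the opposite bit is optimal exactly where the vote is tied
    ([remoteness_Maj_leqif]).  Hence the medians are the vertices obtained from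
    [Maj p] by flipping an arbitrary set of tied coordinates ([mem_Med],
    [Med_imset]), and there are [2 ^ Cs p] of them, so that [Med] satisfies the
    majority and range axioms; translations are isometries of the cube, so that
    it also satisfies the translation axiom.

    Conversely, let [f] satisfy the three axioms and let [x] be a median of [p].
    The translation by [v := Maj p + x] only flips tied coordinates, and a
    flipped tie is still a tie, so [p + v] has the same majority vertex as [p]
    ([Maj_translate_tied]).  Thus [Maj p] is in [f (p + v)], and translating
    back gives [Maj p + v = x] in [f p].  This shows that [Med p] is a subset of
    [f p], and the range axiom leaves room for nothing more. *)

Set Implicit Arguments.
Unset Strict Implicit.
Unset Printing Implicit Defensive.

Section Translation.

Variable n : nat.
Implicit Types (p : profile n) (u v w x : cube n).

Lemma oplusK v : involutive (fun u => oplus u v).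
Proof. by move=> u; apply/ffunP=> i; rewrite !ffunE -addbA addbb addbF. Qed.

Lemma oplusKl u v : oplus u (oplus u v) = v.
Proof. by apply/ffunP=> i; rewrite !ffunE addbA addbb. Qed.

Lemma translateK p v : translate (translate p v) v = p.
Proof.
by apply/val_inj => /=; rewrite -map_comp map_id_in // => w _; apply: oplusK.
Qed.

Lemma dist_addb u v : dist u v = \sum_(i < n) (u i (+) v i).
Proof. by apply: eq_bigr => i _; case: (u i); case: (v i). Qed.

Lemma dist_oplus u v w : dist (oplus u w) (oplus v w) = dist u v.
Proof.
rewrite !dist_addb; apply: eq_bigr => i _.
by rewrite !ffunE addbACA addbb addbF.
Qed.

Lemma remoteness_translate p v x :
  remoteness (translate p v) (oplus x v) = remoteness p x.
Proof.
by rewrite /remoteness /= big_map; apply: eq_bigr => w _; apply: dist_oplus.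
Qed.

Lemma Med_translate p u v : u \in Med p -> oplus u v \in Med (translate p v).
Proof.
rewrite !inE => /forallP min_u; apply/forallP=> y.
by rewrite -[y](oplusK v) !remoteness_translate.
Qed.

End Translation.

Section Medians.

Variable n : nat.
Implicit Types (p : profile n) (v x : cube n) (i : 'I_n) (b : bool).

Definition against p i b : nat := \sum_(w <- votes p) (b (+) w i).

Definition ties p : {set 'I_n} := [set i | 2 * ones p i == size p].

Lemma remotenessE p x : remoteness p x = \sum_(i < n) against p i (x i).
Proof.
by rewrite exchange_big; apply: eq_bigr => w _; rewrite dist_addb.
Qed.

Lemma against_false p i : against p i false = ones p i.
Proof. by []. Qed.

Lemma against_true p i : against p i true + ones p i = size p.
Proof.
rewrite /against /ones -big_split -sum1_size /=.
by apply: eq_bigr => w _; case: (w i).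
Qed.

Lemma ones_translate p v i : ones (translate p v) i = against p i (v i).
Proof.
by rewrite /ones /= big_map; apply: eq_bigr => w _; rewrite ffunE addbC.
Qed.

Lemma against_tied p i b : i \in ties p -> 2 * against p i b = size p.
Proof.
rewrite inE => /eqP tie_i; have := against_true p i.
by case: b; rewrite ?against_false //; lia.
Qed.

(** The two possible bits split the votes, so the one with the majority has at
    most half of them against it; the equality case is recorded because it is
    what determines the whole set of medians once summed over [i]. *)
Lemma against_Maj_leqif p i b :
  against p i (Maj p i) <= against p i b ?= iff (i \in ties p) || (b == Maj p i).
Proof.
have := against_true p i; rewrite !inE ffunE.
by case: ltnP => maj_i; case: b; rewrite ?against_false ?orbT ?orbF => total;
  split; rewrite ?leqnn ?eqxx //; lia.
Qed.

Lemma remoteness_Maj_leqif p x :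
  remoteness p (Maj p) <= remoteness p x
    ?= iff [forall i, (i \in ties p) || (x i == Maj p i)].
Proof.
by rewrite !remotenessE; apply: leqif_sum => i _; apply: against_Maj_leqif.
Qed.

Lemma mem_Med p x :
  (x \in Med p) = [forall i, (i \in ties p) || (x i == Maj p i)].
Proof.
rewrite -(remoteness_Maj_leqif p x) inE; apply/forallP/eqP => [min_x | eq_x y].
  by apply/eqP; rewrite eqn_leq min_x (remoteness_Maj_leqif p x).
by rewrite -eq_x (remoteness_Maj_leqif p y).
Qed.

Lemma Maj_in_Med p : Maj p \in Med p.
Proof. by rewrite mem_Med; apply/forallP=> i; rewrite eqxx orbT. Qed.

Definition flip x (A : {set 'I_n}) : cube n := [ffun i => x i (+) (i \in A)].

Lemma flip_inj x : injective (flip x).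
Proof.
move=> A B /ffunP eqAB; apply/setP=> i.
by have := eqAB i; rewrite !ffunE => /addbI.
Qed.

Lemma Med_imset p : Med p = flip (Maj p) @: powerset (ties p).
Proof.
apply/setP=> x; rewrite mem_Med; apply/forallP/imsetP.
- move=> tie_or_eq; exists [set i | x i != Maj p i].
    rewrite inE; apply/subsetP=> i; rewrite [i \in [set _ | _]]inE => ne_i.
    by have := tie_or_eq i; rewrite (negPf ne_i) orbF.
  apply/ffunP=> i; rewrite [RHS]ffunE [i \in [set _ | _]]inE.
  by case: (x i); case: (Maj p i).
case=> A; rewrite inE => /subsetP sAT -> i; rewrite [flip _ _ _]ffunE.
by case: (boolP (i \in A)) => [/sAT -> // | _]; rewrite addbF eqxx orbT.
Qed.

Lemma card_Med p : #|Med p| = 2 ^ Cs p.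
Proof. by rewrite Med_imset card_imset ?card_powerset //; apply: flip_inj. Qed.

(** Exchanging the two sides of a tie leaves a tie, and at a tie the strict
    inequality in [Maj] gives the bit 0 before and after the translation. *)
Lemma Maj_translate_tied p v :
  (forall i, v i -> i \in ties p) -> Maj (translate p v) = Maj p.
Proof.
move=> tied_v; apply/ffunP=> i; rewrite !ffunE ones_translate size_map.
case vi: (v i); last by rewrite against_false.
by rewrite -against_false !against_tied //; apply: tied_v; rewrite vi.
Qed.

Lemma Med_sub (f : location n) :
  axiomT f -> axiomMaj f -> forall p, Med p \subset f p.
Proof.
move=> fT fMaj p; apply/subsetP=> x; rewrite mem_Med => /forallP tie_or_eq.
(* The translation by v exchanges x and Maj p. *)
pose v := oplus (Maj p) x.
have tied_v i : v i -> i \in ties p.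
  have := tie_or_eq i; rewrite /v [oplus _ _ _]ffunE.
  by case: (i \in ties p) => //= /eqP ->; rewrite addbb.
have := fT _ _ v (fMaj (translate p v)).
by rewrite translateK Maj_translate_tied // oplusKl.
Qed.

End Medians.

Theorem theorem2 (n : nat) (f : location n) :
  f =1 @Med n <-> axiomT f /\ axiomMaj f /\ axiomRR f.
Proof.
split=> [fMed | [fT [fMaj fRR]] p].
  split=> [p u v | ]; first by rewrite !fMed; apply: Med_translate.
  by split=> p; rewrite fMed ?Maj_in_Med // card_Med.
by apply/esym/eqP; rewrite eqEcard Med_sub // card_Med fRR.
Qed.
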